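(* Let $n\ge 1$ be an integer, let $\{|\psi^0_0\rangle,|\psi^0_1\rangle\}$ and $\{|\psi^1_0\rangle,|\psi^1_1\rangle\}$ be two orthonormal bases of $\mathbb{C}^2$, and let $$c:=\max_{x,y\in\{0,1\}}|\langle\psi^0_x|\psi^1_y\rangle|,\qquad \lambda_0=\frac{1+c}{2},\qquad \lambda_1=\frac{1-c}{2}.$$ Let the error threshold be $\delta$, where either $\delta=0$ or $0<\delta<\lambda_1$. Consider the relativistic quantum bit commitment protocol described in the context, and let $p_0,p_1$ denote the probabilities that honest Bob accepts the opening of $0$, respectively $1$. Then for any strategy of dishonest Alice, $$p_0+p_1\le 1+\varepsilon,$$ where $$\varepsilon=\begin{cases}\lambda_0^{\,n} & \text{if }\delta=0,\\[4pt] \exp\!\Big(-\tfrac12\big(\sqrt{\lambda_1}-\tfrac{\delta}{\sqrt{\lambda_1}}\big)^2 n\Big) & \text{if }0<\delta<\lambda_1.\end{cases}$$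
   Context: Notation. For $x,\theta\in\{0,1\}^n$ let $|x^\theta\rangle=\bigotimes_{k=1}^n|\psi^{\theta_k}_{x_k}\rangle\in(\mathbb{C}^2)^{\otimes n}$. For $\theta\in\{0,1\}^n$ let $S=\{k:\theta_k=0\}$ and $T=\{k:\theta_k=1\}$. For a string $x$ and a set $R$ of indices, $x_R$ is the substring indexed by $R$. $d_H$ is the fractional Hamming distance (number of differing positions divided by the length); for empty strings the condition $d_H\le\delta$ is considered to be satisfied. Protocol and strategies (entanglement-based formulation). Honest Bob holds an $n$-qubit system $B$. Dishonest Alice has two agents, Alice$_1$ and Alice$_2$, who cannot communicate with each other in the open phase but who both know the bit $d\in\{0,1\}$ they are asked to open. A strategy of dishonest Alice consists of: (i) a quantum state (density operator) $\sigma_{BA_1A_2}$ on $(\mathbb{C}^2)^{\otimes n}\otimes\mathcal{H}_{A_1}\otimes\mathcal{H}_{A_2}$, with $\mathcal{H}_{A_1},\mathcal{H}_{A_2}$ arbitrary finite-dimensional Hilbert spaces, whose marginal on $B$ is maximally mixed: $\mathrm{tr}_{A_1A_2}\,\sigma_{BA_1A_2}=(\mathbb{1}/2)^{\otimes n}$; (ii) for each $d\in\{0,1\}$, measurements $\{P^d_y\}_{y\in\{0,1\}^n}$ on $\mathcal{H}_{A_1}$ and $\{Q^d_y\}_{y\in\{0,1\}^n}$ on $\mathcal{H}_{A_2}$ (positive semidefinite operators summing to the identity). Bob picks $\theta\in\{0,1\}^n$ uniformly at random and measures $B$ with $\{|x^\theta\rangle\langle x^\theta|\}_{x\in\{0,1\}^n}$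 to obtain $x$. When opening $d$, Alice$_1$ and Alice$_2$ each announce the outcome of their measurement for $d$; Bob accepts iff both announce the same string $y$ and $d_H(x_S,y_S)\le\delta$ (if $d=0$), respectively $d_H(x_T,y_T)\le\delta$ (if $d=1$). Hence $$p_d=2^{-n}\sum_{\theta\in\{0,1\}^n}\mathrm{tr}(\Pi^\theta_d\,\sigma_{BA_1A_2}),\qquad \Pi_0^\theta=\sum_{x}|x^\theta\rangle\langle x^\theta|\otimes\!\!\sum_{y:\,d_H(x_S,y_S)\le\delta}\!\!P^0_y\otimes Q^0_y,$$ $$\Pi_1^\theta=\sum_{x}|x^\theta\rangle\langle x^\theta|\otimes\!\!\sum_{y:\,d_H(x_T,y_T)\le\delta}\!\!P^1_y\otimes Q^1_y.$$ *)

(* Defs.v *)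
From mathcomp Require Import all_boot all_order all_algebra.
From mathcomp.real_closed Require Export complex mxtens.
From mathcomp Require Import reals sequences exp.

Set Implicit Arguments.
Unset Strict Implicit.
Unset Printing Implicit Defensive.

Import Order.TTheory GRing.Theory Num.Theory.

Local Open Scope ring_scope.
Local Open Scope complex_scope.
Local Open Scope sesquilinear_scope.

Notation bits n := {ffun 'I_n -> bool}.

(** The computational basis of (C^2)^{(x) n} is indexed by the functions
    'I_n -> 'I_2, numbered through [enum_val]; its dimension is [qdim n]. *)
Notation qindex n := {ffun 'I_n -> 'I_2}.
Definition qdim (n : nat) : nat := #|{: qindex n}|.

Section LinearAlgebra.
Variable R : rcfType.
Local Notation C := R[i].

Definition inner m (u v : 'cV[C]_m) : C := (u ^t* *m v) 0 0.

Definition projector m (u : 'cV[C]_m) : 'M[C]_m := u *m u ^t*.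

(** In R[i], [0 <= z] means that z is real and nonnegative. *)
Definition psd m (A : 'M[C]_m) : Prop :=
  A \is hermsymmx /\ forall v : 'cV[C]_m, 0 <= inner v (A *m v).

Definition density m (A : 'M[C]_m) : Prop := psd A /\ \tr A = 1.

Definition measurement (Y : finType) m (M : Y -> 'M[C]_m) : Prop :=
  (forall y, psd (M y)) /\ \sum_y M y = 1%:M.

(** Trace over the second factor of a tensor product. *)
Definition ptrace2 b m (A : 'M[C]_(b * m)) : 'M[C]_b :=
  \matrix_(i, j) \sum_(k < m) A (mxtens_index (i, k)) (mxtens_index (j, k)).

(** Two orthonormal vectors of C^2 necessarily span it. *)
Definition orthonormal_basis2 (e : bool -> 'cV[C]_2) : Prop :=
  forall x y, inner (e x) (e y) = (x == y)%:R.

End LinearAlgebra.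

Section Protocol.
Variables (R : realType) (n : nat).
Local Notation C := R[i].
(* [psi t x] is the x-th vector of the t-th basis *)
Variable psi : bool -> bool -> 'cV[C]_2.

(** The norm of R[i] is R[i]-valued; [Re] brings it back to R.  The maximum
    may start at 0, the moduli being nonnegative. *)
Definition overlap : R :=
  \big[Num.max/0]_(x : bool) \big[Num.max/0]_(y : bool)
    complex.Re `|inner (psi false x) (psi true y)|.

Definition lambda0 : R := (1 + overlap) / 2.
Definition lambda1 : R := (1 - overlap) / 2.

(** The vector |x^theta>: component z of the tensor product of the n vectors
    [psi (theta k) (x k)]. *)
Definition ket (x theta : bits n) : 'cV[C]_(qdim n) :=
  \col_(z < qdim n) \prod_(k < n) psi (theta k) (x k) (enum_val z k) 0.

(** Fractional Hamming distance between the substrings indexed by A. *)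
Definition dH (A : {set 'I_n}) (x y : bits n) : R :=
  #|[set k in A | x k != y k]|%:R / #|A|%:R.

Definition close (delta : R) (A : {set 'I_n}) (x y : bits n) : bool :=
  (A == set0) || (dH A x y <= delta).

(** The positions checked when opening d: S for d = 0, T for d = 1. *)
Definition checked (d : bool) (theta : bits n) : {set 'I_n} :=
  [set k | theta k == d].

Record strategy := Strategy {
  dimA1 : nat;
  dimA2 : nat;
  sigma : 'M[C]_(qdim n * (dimA1 * dimA2));
  measA1 : bool -> bits n -> 'M[C]_dimA1;
  measA2 : bool -> bits n -> 'M[C]_dimA2;
  sigma_density : density sigma;
  sigma_marginal : ptrace2 sigma = (2^-1 ^+ n)%:M;
  measA1P : forall d, measurement (measA1 d);
  measA2P : forall d, measurement (measA2 d)
}.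

Definition accept_op (delta : R) (s : strategy) (d : bool) (theta : bits n) :
    'M[C]_(qdim n * (dimA1 s * dimA2 s)) :=
  \sum_(x : bits n) projector (ket x theta) *t
    (\sum_(y : bits n | close delta (checked d theta) x y)
       measA1 s d y *t measA2 s d y).

Definition accept_prob (delta : R) (s : strategy) (d : bool) : C :=
  2^-1 ^+ n * \sum_(theta : bits n) \tr (accept_op delta s d theta *m sigma s).

Definition epsilon (delta : R) : R :=
  if delta == 0 then lambda0 ^+ n
  else expR (- (2^-1 * (Num.sqrt lambda1 - delta / Num.sqrt lambda1) ^+ 2 *
                n%:R)).

End Protocol.

(* Main.v *)
(** By commutation, Alice_1's measurement for opening 0 and Alice_2's
    measurement for opening 1 can be performed jointly: dropping the other agent's answer
    only increases the acceptance probabilities, which are then the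
    probabilities of two events E_0, E_1 on one probability space (Bob's outcome
    x and the announced strings y_0, y_1).  Hence
    p_0 + p_1 <= 1 + Pr(E_0 and E_1).  If both events occur, then x differs
    in at most delta n positions from the string taking its k-th bit from y_(theta_k).
    For fixed y_0, y_1 and a Chernoff parameter t in [0,1], the average over
    theta of the operator t^(number of errors) is a tensor product of one-qubit
    operators t + (1 - t) (|a><a| + |b><b|) / 2 with |<a|b>| <= c, each bounded
    by t + (1 - t) lambda_0. *)

Require Import Defs.
From mathcomp Require Import all_boot all_order all_algebra.
From mathcomp Require Import reals sequences exp.
From mathcomp Require Import ring lra.

Set Implicit Arguments.
Unset Strict Implicit.
Unset Printing Implicit Defensive.

Import Order.TTheory GRing.Theory Num.Theory.

Local Open Scope ring_scope.
Local Open Scope complex_scope.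
Local Open Scope sesquilinear_scope.

(** * Adjoints and Gram factorization *)

Section Adjoint.
Variable C : numClosedFieldType.

Lemma adjmx_mul m n p (A : 'M[C]_(m, n)) (B : 'M[C]_(n, p)) :
  (A *m B) ^t* = B ^t* *m A ^t*.
Proof. by rewrite trmx_mul map_mxM. Qed.

(** The spectral theorem gives A = P^H D P with P unitary and D diagonal; positivity makes D
    nonnegative, and X = sqrt(D) P. *)
Lemma hermitian_gram m (A : 'M[C]_m) :
  A \is hermsymmx -> (forall v : 'cV[C]_m, 0 <= (v ^t* *m (A *m v)) 0 0) ->
  exists X : 'M[C]_m, A = X ^t* *m X.
Proof.
move=> hA pA; have /orthomx_spectralP := hermitian_normalmx hA.
set P := spectralmx A; set d := spectral_diag A => eA.
have uP : P \is unitarymx by apply: spectral_unitarymx.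
rewrite invmx_unitary // in eA.
have d_ge0 i : 0 <= d 0 i.
  (* The test vector is the i-th eigenvector, where the quadratic form takes the value [d 0 i]. *)
  have := pA (P ^t* *m delta_mx i 0); rewrite eA adjmx_mul trmxCK.
  rewrite !mulmxA mulmxtVK // -!mulmxA.
  rewrite [P *m _]mulmxA (unitarymxP uP) mul1mx.
  by rewrite trmx_delta map_delta_mx -rowE -colE !mxE eqxx mulr1n.
exists (diag_mx (\row_i sqrtC (d 0 i)) *m P).
rewrite adjmx_mul tr_diag_mx map_diag_mx !mulmxA.
rewrite -[_ *m diag_mx _ *m diag_mx _]mulmxA mulmx_diag [LHS]eA.
congr (_ *m diag_mx _ *m _); apply/rowP => i; rewrite !mxE.
by rewrite /= geC0_conj ?sqrtC_ge0 // -expr2 sqrtCK.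
Qed.

End Adjoint.

(** * Hermitian inner product and a bound for two unit vectors *)

Section HermitianDot.
Variable C : numClosedFieldType.

(** Same body as [inner], over any closed field; on [R[i]] the two are convertible, so these lemmas
    apply to [inner]. *)
Definition hdot m (u v : 'cV[C]_m) : C := (u ^t* *m v) 0 0.

Lemma hdotE m (u v : 'cV[C]_m) : hdot u v = \sum_i (u i 0)^*%R * v i 0.
Proof. by rewrite /hdot mxE; apply: eq_bigr => i _; rewrite !mxE. Qed.

Lemma hdot_ge0 m (v : 'cV[C]_m) : 0 <= hdot v v.
Proof.
by rewrite hdotE; apply: sumr_ge0 => i _; rewrite mulrC; apply: mul_conjC_ge0.
Qed.

Lemma hdot_conj m (u v : 'cV[C]_m) : (hdot u v)^*%R = hdot v u.
Proof.
rewrite !hdotE rmorph_sum; apply: eq_bigr => i _.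
by rewrite rmorphM /= conjCK mulrC.
Qed.

Lemma hdotDr m (u v w : 'cV[C]_m) : hdot u (v + w) = hdot u v + hdot u w.
Proof. by rewrite /hdot mulmxDr mxE. Qed.

Lemma hdotZr m c (u v : 'cV[C]_m) : hdot u (c *: v) = c * hdot u v.
Proof. by rewrite /hdot -scalemxAr mxE. Qed.

Lemma hdotDl m (u v w : 'cV[C]_m) : hdot (u + v) w = hdot u w + hdot v w.
Proof. by rewrite -hdot_conj hdotDr rmorphD /= !hdot_conj. Qed.

Lemma hdotZl m c (u v : 'cV[C]_m) : hdot (c *: u) v = c^*%R * hdot u v.
Proof. by rewrite -hdot_conj hdotZr rmorphM /= hdot_conj. Qed.

(* With [w = <a,v> a + <b,v> b] and [s = |<a,v>|^2 + |<b,v>|^2], one has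
   [<w,v> = s] and [|w|^2 <= (1 + c) s]; expand [0 <= |(1 + c) v - w|^2]. *)
Lemma two_unit_vectors m (a b v : 'cV[C]_m) (c : C) :
  hdot a a = 1 -> hdot b b = 1 -> `|hdot a b| <= c ->
  `|hdot a v| ^+ 2 + `|hdot b v| ^+ 2 <= (1 + c) * hdot v v.
Proof.
move=> a1 b1 ab_le.
have c_ge0 : 0 <= c by apply: le_trans ab_le.
have c1_gt0 : 0 < 1 + c by rewrite ltr_pwDl.
pose al := hdot a v; pose be := hdot b v.
rewrite -/al -/be; set s := _ + _.
pose w := al *: a + be *: b.
have wv : hdot w v = s by rewrite hdotDl !hdotZl /s !normCKC.
have s_ge0 : 0 <= s by rewrite addr_ge0 // exprn_ge0.
have vw : hdot v w = s by rewrite -hdot_conj wv geC0_conj.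
have ww : hdot w w <= (1 + c) * s.
  pose X := al^*%R * (be * hdot a b).
  have -> : hdot w w = s + (X + X^*%R).
    rewrite hdotDl !hdotZl !hdotDr !hdotZr a1 b1 -(hdot_conj a b) /s !normCKC.
    by rewrite /X !rmorphM /= conjCK; ring.
  rewrite mulrDl mul1r lerD2l.
  have realX : X + X^*%R \is Num.real.
    by apply/CrealP; rewrite rmorphD /= conjCK addrC.
  apply: le_trans (real_ler_norm realX) _.
  apply: le_trans (ler_normD _ _) _.
  have -> : `|X| + `|X^*%R| = (`|al| * `|be|) *+ 2 * `|hdot a b|.
    by rewrite norm_conjC /X !normrM norm_conjC; ring.
  (* The factors are compared separately: |<a,b>| <= c, and 2 |al| |be| <= s because (|al| - |be|)^2
     >= 0. *)
  rewrite mulrC ler_pM // ?mulrn_wge0 ?mulr_ge0 // -subr_ge0.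
  have -> : s - (`|al| * `|be|) *+ 2 = (`|al| - `|be|) ^+ 2 by rewrite /s; ring.
  by rewrite real_exprn_even_ge0 // rpredB // normr_real.
have := hdot_ge0 ((1 + c) *: v + (-1) *: w).
rewrite hdotDl !hdotZl !hdotDr !hdotZr wv vw.
rewrite (geC0_conj (ltW c1_gt0)) rmorphN1 => ge0.
(* Multiplied by 1 + c, the goal exceeds |(1 + c) v - w|^2 by (1 + c) s - |w|^2, nonnegative by
   [ww]. *)
rewrite -subr_ge0 -(pmulr_rge0 _ c1_gt0); apply: le_trans ge0 _.
rewrite -subr_ge0.
have -> : (1 + c) * ((1 + c) * hdot v v - s) -
   ((1 + c) * ((1 + c) * hdot v v + -1 * s) +
     -1 * ((1 + c) * s + -1 * hdot w w)) = (1 + c) * s - hdot w w by ring.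
by rewrite subr_ge0.
Qed.

End HermitianDot.

(** * The cone of positive semidefinite matrices *)

Section Psd.
Variable R : rcfType.
Local Notation C := R[i].

Lemma adjmx_tens m n p q (A : 'M[C]_(m, n)) (B : 'M[C]_(p, q)) :
  (A *t B) ^t* = A ^t* *t B ^t*.
Proof. by rewrite trmx_tens map_mxT. Qed.

Lemma inner_gram m n (X : 'M[C]_(m, n)) v :
  inner v (X ^t* *m X *m v) = inner (X *m v) (X *m v).
Proof. by rewrite /inner adjmx_mul !mulmxA. Qed.

Lemma psd_gram m n (X : 'M[C]_(m, n)) : psd (X ^t* *m X).
Proof.
split; last by move=> v; rewrite inner_gram; apply: hdot_ge0.
by rewrite is_hermitianmxE scale1r adjmx_mul trmxCK.
Qed.

(** With [psd_gram], this identifies positive matrices with Gram matrices, so that products and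
    traces reduce to computations on the factors. *)
Lemma psdP m (A : 'M[C]_m) : psd A -> exists X : 'M[C]_m, A = X ^t* *m X.
Proof. by case; apply: hermitian_gram. Qed.

Lemma psd0 m : psd (0 : 'M[C]_m).
Proof. by have := psd_gram (0 : 'M[C]_m); rewrite mulmx0. Qed.

Lemma psdD m (A B : 'M[C]_m) : psd A -> psd B -> psd (A + B).
Proof.
move=> [hA pA] [hB pB]; split.
  move: hA hB; rewrite !is_hermitianmxE !scale1r => /eqP eA /eqP eB.
  by rewrite linearD map_mxD -eA -eB.
by move=> v; rewrite /inner mulmxDl mulmxDr mxE addr_ge0 ?pA ?pB.
Qed.

Lemma psd_sum m (I : Type) (r : seq I) (P : pred I) (F : I -> 'M[C]_m) :
  (forall i, P i -> psd (F i)) -> psd (\sum_(i <- r | P i) F i).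
Proof. by move=> pF; apply: (big_ind _ (@psd0 m) (@psdD m)). Qed.

Lemma psdZ m (c : C) (A : 'M[C]_m) : 0 <= c -> psd A -> psd (c *: A).
Proof.
move=> c_ge0 [hA pA]; split; last first.
  by move=> v; rewrite /inner -scalemxAl -scalemxAr mxE mulr_ge0 ?pA.
move: hA; rewrite !is_hermitianmxE !scale1r => /eqP eA.
by rewrite linearZ map_mxZ -eA /= geC0_conj.
Qed.

Lemma psd1 m : psd (1%:M : 'M[C]_m).
Proof.
by have := psd_gram (1%:M : 'M[C]_m); rewrite trmx1 map_mx1 mulmx1.
Qed.

Lemma psd_projector m (u : 'cV[C]_m) : psd (projector u).
Proof. by have := psd_gram (u ^t*); rewrite trmxCK. Qed.

Lemma psd_tens m n (A : 'M[C]_m) (B : 'M[C]_n) :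
  psd A -> psd B -> psd (A *t B).
Proof.
move=> /psdP [X ->] /psdP [Y ->].
by rewrite -tensmx_mul -adjmx_tens; apply: psd_gram.
Qed.

Lemma trace_psd_ge0 m (A : 'M[C]_m) : psd A -> 0 <= \tr A.
Proof.
move=> /psdP [X ->]; apply: sumr_ge0 => i _; rewrite mxE.
by apply: sumr_ge0 => j _; rewrite !mxE mulrC mul_conjC_ge0.
Qed.

(** For A = X^H X and B = Y^H Y, cyclicity turns the trace into that of Z^H Z with Z = Y X^H. *)
Lemma trace_mul_psd_ge0 m (A B : 'M[C]_m) : psd A -> psd B -> 0 <= \tr (A *m B).
Proof.
move=> /psdP [X ->] /psdP [Y ->].
rewrite -mulmxA mxtrace_mulC -2!mulmxA mulmxA.
rewrite -{1}[X]trmxCK -adjmx_mul.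
exact/trace_psd_ge0/psd_gram.
Qed.

End Psd.

(** * Tensor products of n one-qubit operators *)

Section TensorFamily.
Variable n : nat.

(** The n-fold Kronecker product, given by its entries in the basis indexing of [ket]; no dimension
    casts arise. *)
Definition tensfam (F : comPzRingType) (W : 'I_n -> 'M[F]_2) : 'M[F]_(qdim n) :=
  \matrix_(z < qdim n, z' < qdim n)
    \prod_k W k (enum_val z k) (enum_val z' k).

Lemma eq_tensfam (F : comPzRingType) (V W : 'I_n -> 'M[F]_2) :
  V =1 W -> tensfam V = tensfam W.
Proof.
move=> eVW; apply/matrixP => z z'; rewrite !mxE.
by apply: eq_bigr => k _; rewrite eVW.
Qed.

Lemma tensfam_mul (F : comNzRingType) (V W : 'I_n -> 'M[F]_2) :
  tensfam (fun k => V k *m W k) = tensfam V *m tensfam W.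
Proof.
apply/matrixP => z z'; rewrite !mxE.
under eq_bigr do rewrite mxE.
rewrite bigA_distr_bigA /= (big_enum_val (A := {: qindex n})) /=.
by apply: eq_bigr => j _; rewrite !mxE -big_split.
Qed.

(** Multilinearity. For J = bool the choice functions are bit strings, so sums over theta and x
    become tensor products. *)
Lemma tensfam_sum (F : comNzRingType) (J : finType) (W : 'I_n -> J -> 'M[F]_2) :
  tensfam (fun k => \sum_j W k j) =
  \sum_(f : {ffun 'I_n -> J}) tensfam (fun k => W k (f k)).
Proof.
apply/matrixP => z z'; rewrite summxE !mxE.
under eq_bigr do rewrite summxE.
by rewrite bigA_distr_bigA /=; apply: eq_bigr => f _; rewrite mxE.
Qed.

Lemma tensfam_scale (F : comNzRingType) (w : 'I_n -> F) (W : 'I_n -> 'M[F]_2) :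
  tensfam (fun k => w k *: W k) = (\prod_k w k) *: tensfam W.
Proof.
apply/matrixP => z z'; rewrite !mxE -big_split.
by apply: eq_bigr => k _; rewrite mxE.
Qed.

Lemma tensfam_scalar (F : comNzRingType) (c : F) :
  tensfam (fun=> c%:M) = (c ^+ n)%:M.
Proof.
apply/matrixP => z z'; rewrite !mxE.
have [<-|neq_z] := eqVneq z z'.
  by under eq_bigr do rewrite mxE eqxx; rewrite prodr_const card_ord.
have [k neq_k] : exists k, enum_val z k != enum_val z' k.
  apply/existsP; apply: contraNT neq_z; rewrite negb_exists => /forallP eq_z.
  apply/eqP/enum_val_inj/ffunP => k; apply/eqP.
  by rewrite -[_ == _]negbK eq_z.
by rewrite (bigD1 k) //= mxE (negbTE neq_k) mul0r.
Qed.

Lemma adjmx_tensfam (C : numClosedFieldType) (W : 'I_n -> 'M[C]_2) :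
  (tensfam W) ^t* = tensfam (fun k => (W k) ^t*).
Proof.
apply/matrixP => z z'; rewrite !mxE rmorph_prod.
by apply: eq_bigr => k _; rewrite !mxE.
Qed.

Variable R : rcfType.
Local Notation C := R[i].

Lemma psd_tensfam (W : 'I_n -> 'M[C]_2) :
  (forall k, psd (W k)) -> psd (tensfam W).
Proof.
move=> pW; have [X eW] := fin_all_exists (fun k => psdP (pW k)).
by rewrite (eq_tensfam eW) tensfam_mul -adjmx_tensfam; apply: psd_gram.
Qed.

(* Expand the product of the sums [W k = V k + (W k - V k)]: every term is
   positive, and one of them is [tensfam V]. *)
Lemma psd_tensfamB (V W : 'I_n -> 'M[C]_2) :
  (forall k, psd (V k)) -> (forall k, psd (W k - V k)) ->
  psd (tensfam W - tensfam V).
Proof.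
move=> pV pWV.
pose D k b := if b then V k else W k - V k.
have -> : tensfam W = tensfam (fun k => \sum_b D k b).
  by apply: eq_tensfam => k; rewrite big_bool /= subrKC.
rewrite tensfam_sum (bigD1 [ffun=> true]) //=.
rewrite (@eq_tensfam _ (fun k => D k _) V); last by move=> k; rewrite ffunE.
rewrite addrAC subrr add0r; apply: psd_sum => f _.
by apply: psd_tensfam => k; rewrite /D; case: ifP.
Qed.

End TensorFamily.

(** * Exponential estimates and the Chernoff parameter *)

Section Chernoff.
Variable R : realType.

(** A partial sum of the exponential series, whose terms are nonnegative. *)
Lemma expR_ge1DxDx2 (x : R) : 0 <= x -> 1 + x + x ^+ 2 / 2 <= expR x.
Proof.
move=> x_ge0.
have -> : 1 + x + x ^+ 2 / 2 = series (exp_coeff x) 3.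
  rewrite /series /= !big_nat_recr //= big_geq // /exp_coeff /=.
  by rewrite !factS fact0 expr0 expr1 /= add0r !divr1.
apply: nondecreasing_cvgn_le; last exact: is_cvg_series_exp_coeff.
apply: nondecreasing_series => k _ _; rewrite /exp_coeff /=.
by rewrite divr_ge0 ?exprn_ge0.
Qed.

(** Follows from the bound on [expR x], since (1 - x + x^2/2) (1 + x + x^2/2) = 1 + x^4/4 >= 1. *)
Lemma expRN_le1BxDx2 (x : R) : 0 <= x -> expR (- x) <= 1 - x + x ^+ 2 / 2.
Proof.
move=> x_ge0; rewrite expRN.
have E := expR_ge1DxDx2 x_ge0.
have q_gt0 : 0 < 1 + x + x ^+ 2 / 2 by nra.
have p_ge0 : 0 <= 1 - x + x ^+ 2 / 2 by nra.
rewrite -[leLHS]mul1r ler_pdivrMr ?expR_gt0 //.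
apply: le_trans (ler_wpM2l p_ge0 E).
have -> : (1 - x + x ^+ 2 / 2) * (1 + x + x ^+ 2 / 2) = 1 + (x ^+ 2 / 2) ^+ 2.
  by field.
by rewrite lerDl sqr_ge0.
Qed.

(* [t] is the Chernoff parameter and [a = t ^ (- delta n)]; for [delta = 0]
   the limit [t = 0] is attained. *)
Lemma chernoff_parameters (n : nat) (delta l0 l1 : R) :
  l0 + l1 = 1 -> 0 <= l0 -> delta = 0 \/ 0 < delta < l1 ->
  exists t a : R,
    [/\ 0 <= t <= 1, 0 <= a,
        forall K : nat, K%:R <= delta * n%:R -> 1 <= a * t ^+ K &
        a * (t + (1 - t) * l0) ^+ n <=
        if delta == 0 then l0 ^+ n
        else expR (- (2^-1 * (Num.sqrt l1 - delta / Num.sqrt l1) ^+ 2 * n%:R))].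
Proof.
move=> l01 l0_ge0 [->|/andP[d_gt0 d_lt]].
  (* Only K = 0 satisfies the constraint, and 0^0 = 1. *)
  exists 0, 1; rewrite eqxx lexx ler01; split=> //.
    move=> K; rewrite mul0r lern0 => /eqP ->.
    by rewrite expr0 mulr1.
  by rewrite add0r subr0 !mul1r.
have l1_gt0 : 0 < l1 by apply: lt_trans d_lt.
(* With t = exp(-g), the logarithm of the bound per qubit is at most g delta - (g - g^2/2) l1. This
   choice of g minimizes it, with value - l1 g^2 / 2. *)
pose g := 1 - delta / l1.
have dE : delta = (1 - g) * l1 by rewrite /g; field; rewrite gt_eqF.
have g_ge0 : 0 <= g by rewrite subr_ge0 ler_pdivrMr // mul1r ltW.
have t_le := expRN_le1BxDx2 g_ge0.
exists (expR (- g)), (expR (g * (delta * n%:R))); rewrite gt_eqF //; split.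
- by rewrite expR_ge0 -[leRHS](@expR0 R) ler_expR oppr_le0.
- exact: expR_ge0.
- move=> K leK; rewrite -expRM_natr -expRD -[leLHS](@expR0 R) ler_expR.
  by rewrite mulNr subr_ge0 ler_wpM2l.
have sqE : (Num.sqrt l1 - delta / Num.sqrt l1) ^+ 2 = l1 * g ^+ 2.
  have s_gt0 : 0 < Num.sqrt l1 by rewrite sqrtr_gt0.
  move: s_gt0 (sqr_sqrtr (ltW l1_gt0)); rewrite /g.
  by move: (Num.sqrt l1) => r r_gt0 <-; field; exact: lt0r_neq0.
move: g g_ge0 dE t_le sqE => g g_ge0 dE t_le sqE.
have b_ge0 : 0 <= expR (- g) + (1 - expR (- g)) * l0.
  rewrite addr_ge0 ?expR_ge0 // mulr_ge0 // subr_ge0.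
  by rewrite -[leRHS](@expR0 R) ler_expR oppr_le0.
(* The left side is 1 - (1 - t) l1, and [t_le] gives 1 - t >= g - g^2/2; then 1 + z <= exp z. *)
have b_le : expR (- g) + (1 - expR (- g)) * l0 <=
            expR (- (g - g ^+ 2 / 2) * l1).
  apply: le_trans (expR_ge1Dx _).
  have -> : l0 = 1 - l1 by rewrite -l01 addrK.
  nra.
apply: le_trans (ler_wpM2l (expR_ge0 _) (lerXn2r n b_ge0 (expR_ge0 _) b_le)) _.
rewrite -expRM_natr -expRD ler_expR sqE dE.
by rewrite le_eqVlt; apply/orP; left; apply/eqP; field.
Qed.

End Chernoff.

(** * Counting errors at the checked positions *)

Section Hamming.
Variables (R : realType) (n : nat).

(** Clearing the denominator absorbs the convention for empty substrings: both sides are then 0. *)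
Lemma close_card (delta : R) (A : {set 'I_n}) (x y : bits n) :
  close delta A x y -> #|[set k in A | x k != y k]|%:R <= delta * #|A|%:R.
Proof.
rewrite /close; have [->|A_neq0] := eqVneq A set0.
  move=> _; rewrite (_ : [set k in _ | _] = set0) ?cards0 ?mulr0 //.
  by apply/setP => k; rewrite !inE.
by rewrite /dH /= ler_pdivrMr // ltr0n card_gt0.
Qed.

(** The two checked sets partition the positions, and position k is tested against [y (theta k)], so
    the two error bounds add up. *)
Lemma errors_card (delta : R) (theta x : bits n) (y : bool -> bits n) :
  close delta (checked false theta) x (y false) ->
  close delta (checked true theta) x (y true) ->
  #|[set k | x k != y (theta k) k]|%:R <= delta * n%:R.
Proof.
move=> /close_card le0 /close_card le1.
have -> : n%:R = #|checked false theta|%:R + #|checked true theta|%:R :> R.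
  rewrite -natrD -[in LHS](card_ord n) -(cardsC (checked false theta)).
  congr (_ + _)%:R; apply: eq_card => k.
  by rewrite !inE; case: (theta k).
rewrite mulrDr; apply: le_trans (lerD le0 le1).
rewrite -natrD ler_nat; apply: leq_trans (leq_card_setU _ _).
apply/subset_leq_card/subsetP => k; rewrite !inE.
by case: (theta k) => /= ->; rewrite ?orbT.
Qed.

End Hamming.

(** * Rank-one projectors *)

Section Qubit.
Variable R : rcfType.
Local Notation C := R[i].

Lemma inner_projector m (u v : 'cV[C]_m) :
  inner v (projector u *m v) = `|inner u v| ^+ 2.
Proof.
rewrite normCKC [X in X * _]hdot_conj /projector /inner /hdot.
by rewrite !mulmxA -[_ *m _ *m v]mulmxA [LHS]mxE big_ord1.
Qed.

(** Operator form of [two_unit_vectors]. *)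
Lemma psd_two_projectors m (a b : 'cV[C]_m) (c : C) :
  inner a a = 1 -> inner b b = 1 -> `|inner a b| <= c ->
  psd ((1 + c)%:M - (projector a + projector b)).
Proof.
move=> a1 b1 ab_le.
have c1_ge0 : 0 <= 1 + c by rewrite addr_ge0 //; apply: le_trans ab_le.
split.
  have [hp _] := psdD (psd_projector a) (psd_projector b).
  have [hc _] := psdZ c1_ge0 (@psd1 R m).
  move: hp hc; rewrite !is_hermitianmxE !scale1r scalemx1 => /eqP ep /eqP ec.
  by rewrite linearB map_mxB -ep -ec.
move=> v; have := two_unit_vectors v a1 b1 ab_le; rewrite -subr_ge0.
congr (0 <= _).
rewrite /inner mulmxBl mulmxBr mulmxDl mulmxDr mul_scalar_mx -scalemxAr.
rewrite [in RHS]mxE [X in _ = X + _]mxE [X in _ = _ + X]mxE.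
rewrite [X in _ = _ - X]mxE.
by congr (_ - (_ + _)); apply/esym/inner_projector.
Qed.

(** For the square matrix U with columns [e false] and [e true], orthonormality is U^H U = 1, hence
    U U^H = 1, which is completeness. *)
Lemma sum_projector2 (e : bool -> 'cV[C]_2) :
  orthonormal_basis2 e -> \sum_x projector (e x) = 1%:M.
Proof.
move=> on_e.
pose U : 'M[C]_2 := \matrix_(i, j) e (j != 0) i 0.
have UU : U ^t* *m U = 1%:M.
  apply/matrixP => i j; rewrite !mxE.
  transitivity (inner (e (i != 0)) (e (j != 0))).
    by rewrite [RHS]hdotE; apply: eq_bigr => k _; rewrite !mxE.
  rewrite on_e; congr (_%:R).
  by case: i j => [[|[|]]] // ? [[|[|]]].
rewrite -(mulmx1C UU); apply/matrixP => i j.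
rewrite summxE big_bool !mxE !big_ord_recl !big_ord0 !mxE /= addr0 addrC.
by rewrite addr0.
Qed.

End Qubit.

(** * Affine identities for the one-qubit error operators *)

Section Affine.

(** Weight 1 at [y] and t elsewhere is weight t everywhere plus an extra 1 - t at [y]. *)
Lemma sum_scale_except1 (F : nzRingType) (V : lmodType F) (I : finType)
    (t : F) (y : I) (p : I -> V) :
  \sum_x (if x == y then 1 else t) *: p x = t *: \sum_x p x + (1 - t) *: p y.
Proof.
rewrite (bigD1 y) // [in RHS](bigD1 y) //= eqxx scalerDr addrAC -scalerDl.
rewrite addrC [t + _]addrC subrK addrC scaler_sumr; congr (_ + _).
by apply: eq_bigr => x /negbTE ->.
Qed.

Variables (F : numFieldType) (m : nat).
Implicit Types (t c : F) (A B : 'M[F]_m).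

Lemma half_mix t A B :
  2^-1 *: ((t%:M + (1 - t) *: A) + (t%:M + (1 - t) *: B)) =
  t%:M + ((1 - t) / 2) *: (A + B).
Proof.
apply/matrixP => i j; rewrite !mxE.
by case: (i == j); rewrite ?mulr1n ?mulr0n; field.
Qed.

(** Reduces the one-qubit bound to [psd_two_projectors]. *)
Lemma scalar_sub_mix t c A :
  (t + (1 - t) * ((1 + c) / 2))%:M - (t%:M + ((1 - t) / 2) *: A) =
  ((1 - t) / 2) *: ((1 + c)%:M - A).
Proof.
apply/matrixP => i j; rewrite !mxE.
by case: (i == j); rewrite ?mulr1n ?mulr0n; field.
Qed.

End Affine.

(** * The error-weighted operator averaged over bases *)

Section Noise.
Variables (R : realType) (n : nat) (psi : bool -> bool -> 'cV[R[i]]_2).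
Local Notation C := R[i].

Lemma projector_ket (x theta : bits n) :
  projector (ket psi x theta) =
  tensfam (fun k => projector (psi (theta k) (x k))).
Proof.
apply/matrixP => z z'; rewrite !mxE big_ord1 !mxE rmorph_prod -big_split.
by apply: eq_bigr => k _; rewrite !mxE big_ord1 !mxE.
Qed.

Hypothesis hpsi : forall t, orthonormal_basis2 (psi t).

Lemma sum_projector_ket (theta : bits n) :
  \sum_x projector (ket psi x theta) = 1%:M.
Proof.
under eq_bigr do rewrite projector_ket.
rewrite -(tensfam_sum (fun k b => projector (psi (theta k) b))).
rewrite (@eq_tensfam _ _ _ (fun=> 1%:M)); last by move=> k; exact: sum_projector2.
by rewrite tensfam_scalar expr1n.
Qed.

(** The weight is a product over positions, so the average factors into one-qubit operators, bounded
    one by one through [psd_tensfamB]. *)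
Lemma psd_noise (Y : bool -> bits n) (t c : C) :
  0 <= t <= 1 ->
  (forall x y, `|inner (psi false x) (psi true y)| <= c) ->
  psd (((t + (1 - t) * ((1 + c) / 2)) ^+ n)%:M -
       2^-1 ^+ n *: \sum_(theta : bits n) \sum_(x : bits n)
         t ^+ #|[set k | x k != Y (theta k) k]| *: projector (ket psi x theta)).
Proof.
move=> /andP[t_ge0 t_le1] hc.
have half_ge0 : 0 <= 2^-1 :> C by rewrite invr_ge0.
pose w b k x := if x == Y b k then 1 else t.
pose W k : 'M[C]_2 := 2^-1 *: \sum_b \sum_x w b k x *: projector (psi b x).
have WE k : W k = t%:M + ((1 - t) / 2) *:
    (projector (psi false (Y false k)) + projector (psi true (Y true k))).
  rewrite -half_mix /W big_bool addrC; congr (_ *: (_ + _));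
    by rewrite sum_scale_except1 sum_projector2 // scalemx1.
have -> : 2^-1 ^+ n *: \sum_(theta : bits n) \sum_(x : bits n)
    t ^+ #|[set k | x k != Y (theta k) k]| *: projector (ket psi x theta) =
    tensfam W.
  rewrite /W (tensfam_scale (fun=> 2^-1)) prodr_const card_ord; congr (_ *: _).
  rewrite tensfam_sum; apply: eq_bigr => theta _.
  rewrite tensfam_sum; apply: eq_bigr => x _.
  rewrite (tensfam_scale (fun k => w (theta k) k (x k))) projector_ket.
  (* The power of t becomes a product over all positions, with factor 1 at those without error. *)
  congr (_ *: _); rewrite -prodr_const [LHS]big_mkcond /=.
  by apply: eq_bigr => k _; rewrite inE /w; case: eqP.
rewrite -tensfam_scalar; apply: psd_tensfamB => k; rewrite WE.
  rewrite -scalemx1; apply: psdD; first exact: psdZ (psd1 _ _).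
  apply: psdZ; first by rewrite mulr_ge0 // subr_ge0.
  by apply: psdD; apply: psd_projector.
rewrite scalar_sub_mix.
apply: psdZ; first by rewrite mulr_ge0 // subr_ge0.
by apply: psd_two_projectors; rewrite ?hpsi ?eqxx.
Qed.

End Noise.

(** * Bilinearity of the Kronecker product *)

Section Tens.
Variable F : comNzRingType.

Lemma tensmx_suml (I : Type) (r : seq I) (P : pred I) m n p q
    (A : I -> 'M[F]_(m, n)) (B : 'M[F]_(p, q)) :
  (\sum_(i <- r | P i) A i) *t B = \sum_(i <- r | P i) (A i *t B).
Proof.
apply/matrixP => i j; rewrite summxE !mxE summxE mulr_suml.
by apply: eq_bigr => k _; rewrite mxE.
Qed.

Lemma tensmx_sumr (I : Type) (r : seq I) (P : pred I) m n p q
    (A : 'M[F]_(m, n)) (B : I -> 'M[F]_(p, q)) :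
  A *t (\sum_(i <- r | P i) B i) = \sum_(i <- r | P i) (A *t B i).
Proof.
apply/matrixP => i j; rewrite summxE !mxE summxE mulr_sumr.
by apply: eq_bigr => k _; rewrite mxE.
Qed.

Lemma tensmxZl m n p q (c : F) (A : 'M[F]_(m, n)) (B : 'M[F]_(p, q)) :
  (c *: A) *t B = c *: (A *t B).
Proof. by apply/matrixP => i j; rewrite !mxE mulrA. Qed.

Lemma tensmxBl m n p q (A B : 'M[F]_(m, n)) (D : 'M[F]_(p, q)) :
  (A - B) *t D = A *t D - B *t D.
Proof. by apply/matrixP => i j; rewrite !mxE mulrBl. Qed.

Lemma tensmxBr m n p q (A : 'M[F]_(m, n)) (B D : 'M[F]_(p, q)) :
  A *t (B - D) = A *t B - A *t D.
Proof. by apply/matrixP => i j; rewrite !mxE mulrBr. Qed.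

Lemma tens11 m n : (1%:M : 'M[F]_m) *t (1%:M : 'M[F]_n) = 1%:M.
Proof.
apply/matrixP => i j.
case: (mxtens_indexP i) => i1 i2; case: (mxtens_indexP j) => j1 j2.
rewrite tensmxE !mxE -natrM mulnb (inj_eq (can_inj (@mxtens_indexK _ _))).
by rewrite xpair_eqE.
Qed.

End Tens.

(** * Operator bound for fixed announced strings *)

Section Bound.
Variables (R : realType) (n : nat) (psi : bool -> bool -> 'cV[R[i]]_2).
Hypothesis hpsi : forall t, orthonormal_basis2 (psi t).
Local Notation C := R[i].

Lemma psd_measurement_le1 (Y : finType) m (M : Y -> 'M[C]_m) y :
  measurement M -> psd (1%:M - M y).
Proof.
case=> pM <-; rewrite (bigD1 y) //= addrAC subrr add0r.
by apply: psd_sum => z _; apply: pM.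
Qed.

Lemma norm_inner_overlap x y :
  `|inner (psi false x) (psi true y)| <= (overlap psi)%:C.
Proof.
rewrite -(RRe_real (normr_real _)) lecR.
by rewrite /overlap; apply: (bigmax_sup x) => //; apply: (bigmax_sup y).
Qed.

Lemma overlap_ge0 : 0 <= overlap psi.
Proof.
rewrite -ler0c.
exact: (le_trans (normr_ge0 _) (norm_inner_overlap true true)).
Qed.

Definition both_close (delta : R) (Y : bool -> bits n) (theta x : bits n) :=
  close delta (checked false theta) x (Y false) &&
  close delta (checked true theta) x (Y true).

(** The Markov step: when both tests pass there are at most delta n errors, so the indicator is at
    most a t^K, K being the number of errors; [psd_noise] bounds the average. *)
Lemma psd_both_close (delta t a : R) (Y : bool -> bits n) :
  0 <= t <= 1 -> 0 <= a ->
  (forall K : nat, K%:R <= delta * n%:R -> 1 <= a * t ^+ K) ->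
  psd ((a * (t + (1 - t) * lambda0 psi) ^+ n)%:C%:M -
       2^-1 ^+ n *: \sum_(theta : bits n) \sum_(x : bits n)
         (both_close delta Y theta x)%:R *: projector (ket psi x theta)).
Proof.
move=> t01 a_ge0 at_ge1.
pose N := \sum_(theta : bits n) \sum_(x : bits n)
  t%:C ^+ #|[set k | x k != Y (theta k) k]| *: projector (ket psi x theta).
pose G := \sum_(theta : bits n) \sum_(x : bits n)
  (both_close delta Y theta x)%:R *: projector (ket psi x theta).
have half_ge0 : 0 <= 2^-1 ^+ n :> C by rewrite exprn_ge0 // invr_ge0.
have aC_ge0 : 0 <= a%:C by rewrite ler0c.
have noise : psd (((t + (1 - t) * lambda0 psi) ^+ n)%:C%:M - 2^-1 ^+ n *: N).
  have tC01 : 0 <= t%:C <= 1 by rewrite -[1]/(1%:C) ler0c lecR.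
  have lamE : (t%:C + (1 - t%:C) * ((1 + (overlap psi)%:C) / 2)) ^+ n =
              ((t + (1 - t) * lambda0 psi) ^+ n)%:C.
    rewrite /lambda0 rmorphXn /= (rmorphD (real_complex R)).
    by rewrite !(rmorphM (real_complex R)) fmorphV rmorphB rmorphD rmorph_nat.
  by have := psd_noise hpsi Y tC01 norm_inner_overlap; rewrite lamE.
have rest : psd (a%:C *: N - G).
  rewrite /N /G scaler_sumr -sumrB; apply: psd_sum => theta _.
  rewrite scaler_sumr -sumrB; apply: psd_sum => x _.
  rewrite scalerA -scalerBl; apply: psdZ; last exact: psd_projector.
  rewrite -rmorphXn -rmorphM.
  case both: (both_close _ _ _ _); last first.
    by case/andP: t01 => t_ge0 _; rewrite subr0 ler0c mulr_ge0 ?exprn_ge0.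
  rewrite subr_ge0 -[1%:R]/(1%:C) lecR; apply: at_ge1.
  by case/andP: both; apply: errors_card.
have -> : (a * (t + (1 - t) * lambda0 psi) ^+ n)%:C%:M - 2^-1 ^+ n *: G =
  a%:C *: (((t + (1 - t) * lambda0 psi) ^+ n)%:C%:M - 2^-1 ^+ n *: N) +
  2^-1 ^+ n *: (a%:C *: N - G).
  rewrite rmorphM !scalerBr scale_scalar_mx.
  by rewrite (scalerA a%:C) (mulrC a%:C (_ ^+ _)) -scalerA addrA subrK.
by apply: psdD; apply: psdZ.
Qed.

End Bound.

(** * From a strategy to a joint probability law *)

Section Attack.
Variables (R : realType) (n : nat) (psi : bool -> bool -> 'cV[R[i]]_2).
Variables (s : strategy R n).
Local Notation C := R[i].
Local Notation P := (measA1 s false).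
Local Notation Q := (measA2 s true).

Definition expect (A : 'M[C]_(qdim n * (dimA1 s * dimA2 s))) : C :=
  \tr (A *m sigma s).

Lemma expect_sum (I : Type) (r : seq I) (p : pred I) A :
  expect (\sum_(i <- r | p i) A i) = \sum_(i <- r | p i) expect (A i).
Proof. by rewrite /expect mulmx_suml raddf_sum. Qed.

Lemma expectZ c A : expect (c *: A) = c * expect A.
Proof. by rewrite /expect -scalemxAl mxtraceZ. Qed.

Lemma expect_le A B : psd (B - A) -> expect A <= expect B.
Proof.
move=> pBA; rewrite -subr_ge0 /expect -raddfB -mulmxBl.
by apply: trace_mul_psd_ge0 => //; case: (sigma_density s).
Qed.

Lemma expect1 : expect 1%:M = 1.
Proof. by rewrite /expect mul1mx; case: (sigma_density s). Qed.

(* The joint law of x, y_0 and y_1, the measurements acting on distinct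
   tensor factors. *)
Definition joint (theta x y0 y1 : bits n) : C :=
  expect (projector (ket psi x theta) *t (P y0 *t Q y1)).

Lemma joint_ge0 theta x y0 y1 : 0 <= joint theta x y0 y1.
Proof.
apply: trace_mul_psd_ge0; last by case: (sigma_density s).
apply: psd_tens; first exact: psd_projector.
by apply: psd_tens; [case: (measA1P s false)|case: (measA2P s true)].
Qed.

Lemma joint_sum0 theta x y1 :
  \sum_y0 joint theta x y0 y1 =
  expect (projector (ket psi x theta) *t (1%:M *t Q y1)).
Proof.
by rewrite /joint -expect_sum -tensmx_sumr -tensmx_suml (measA1P s false).2.
Qed.

Lemma joint_sum1 theta x y0 :
  \sum_y1 joint theta x y0 y1 =
  expect (projector (ket psi x theta) *t (P y0 *t 1%:M)).
Proof. by rewrite /joint -expect_sum -!tensmx_sumr (measA2P s true).2. Qed.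

Variable delta : R.

(** Bounding Alice_2's operator for opening 0 by the identity drops her answer; that identity is
    then resolved by her measurement for opening 1. *)
Lemma accept_joint0 theta :
  expect (accept_op psi delta s false theta) <=
  \sum_x \sum_y0 \sum_y1
    (close delta (checked false theta) x y0)%:R * joint theta x y0 y1.
Proof.
rewrite /accept_op expect_sum; apply: ler_sum => x _.
rewrite tensmx_sumr expect_sum big_mkcond /=; apply: ler_sum => y _.
rewrite -mulr_sumr joint_sum1; case: ifP => _; last by rewrite mul0r.
rewrite mul1r; apply: expect_le; rewrite -!tensmxBr.
apply: psd_tens; first exact: psd_projector.
apply: psd_tens; first by case: (measA1P s false).
exact/psd_measurement_le1/(measA2P s false).
Qed.

Lemma accept_joint1 theta :
  expect (accept_op psi delta s true theta) <=
  \sum_x \sum_y0 \sum_y1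
    (close delta (checked true theta) x y1)%:R * joint theta x y0 y1.
Proof.
rewrite /accept_op expect_sum; apply: ler_sum => x _.
rewrite exchange_big /=.
rewrite tensmx_sumr expect_sum big_mkcond /=; apply: ler_sum => y _.
rewrite -mulr_sumr joint_sum0; case: ifP => _; last by rewrite mul0r.
rewrite mul1r; apply: expect_le; rewrite -tensmxBr -tensmxBl.
apply: psd_tens; first exact: psd_projector.
apply: psd_tens; last by case: (measA2P s true).
exact/psd_measurement_le1/(measA1P s true).
Qed.

Hypothesis hpsi : forall t, orthonormal_basis2 (psi t).

Lemma joint_total theta : \sum_x \sum_y0 \sum_y1 joint theta x y0 y1 = 1.
Proof.
under eq_bigr => x _.
  under eq_bigr do rewrite joint_sum1.
  rewrite -expect_sum -tensmx_sumr -tensmx_suml (measA1P s false).2 tens11.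
over.
by rewrite -expect_sum -tensmx_suml sum_projector_ket // tens11 expect1.
Qed.

(** The operator bound holds for each pair of strings; tensoring it with [P y0 *t Q y1] and summing
    preserves it, as these operators sum to the identity. *)
Lemma both_joint_le (e : C) :
  (forall Y : bool -> bits n,
    psd (e%:M - 2^-1 ^+ n *: \sum_(theta : bits n) \sum_(x : bits n)
      (both_close delta Y theta x)%:R *: projector (ket psi x theta))) ->
  2^-1 ^+ n * (\sum_theta \sum_x \sum_y0 \sum_y1
    (both_close delta (fun b => if b then y1 else y0) theta x)%:R *
    joint theta x y0 y1) <= e.
Proof.
move=> He.
have -> : e = \sum_y0 \sum_y1 expect (e%:M *t (P y0 *t Q y1)).
  under eq_bigr => y0 _ do
    rewrite -expect_sum -!tensmx_sumr (measA2P s true).2.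
  rewrite -expect_sum -tensmx_sumr -tensmx_suml (measA1P s false).2 tens11.
  by rewrite -(scalemx1 _ e) tensmxZl tens11 expectZ expect1 mulr1.
(* The sums over y0 and y1 move outermost, since the operator bound needs the strings fixed while
   theta and x vary. *)
under eq_bigr => theta _ do rewrite exchange_big /=.
rewrite exchange_big /= mulr_sumr; apply: ler_sum => y0 _.
under eq_bigr => theta _ do rewrite exchange_big /=.
rewrite exchange_big /= mulr_sumr; apply: ler_sum => y1 _.
set Y := fun b : bool => if b then y1 else y0.
have -> : 2^-1 ^+ n * (\sum_theta \sum_x
    (both_close delta Y theta x)%:R * joint theta x y0 y1) =
  expect ((2^-1 ^+ n *: \sum_(theta : bits n) \sum_(x : bits n)
    (both_close delta Y theta x)%:R *: projector (ket psi x theta))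
    *t (P y0 *t Q y1)).
  rewrite tensmxZl expectZ tensmx_suml expect_sum; congr (_ * _).
  apply: eq_bigr => theta _; rewrite tensmx_suml expect_sum.
  by apply: eq_bigr => x _; rewrite tensmxZl expectZ.
apply: expect_le; rewrite -tensmxBl; apply: psd_tens => //.
by apply: psd_tens; [case: (measA1P s false)|case: (measA2P s true)].
Qed.

(** Pointwise, the indicators of two events sum to at most 1 plus that of their intersection; this
    is summed against the nonnegative weights [joint]. *)
Lemma accept_prob_le (e : C) :
  (forall Y : bool -> bits n,
    psd (e%:M - 2^-1 ^+ n *: \sum_(theta : bits n) \sum_(x : bits n)
      (both_close delta Y theta x)%:R *: projector (ket psi x theta))) ->
  accept_prob psi delta s false + accept_prob psi delta s true <= 1 + e.
Proof.
move=> /both_joint_le le_e.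
have half_gt0 : 0 < 2^-1 ^+ n :> C by rewrite exprn_gt0 // invr_gt0.
rewrite /accept_prob -mulrDr -big_split /=.
apply: le_trans (lerD (lexx 1) le_e).
(* The constant 1 is spread out as the total mass, to allow a termwise comparison. *)
have total : 2^-1 ^+ n * (\sum_theta \sum_x \sum_y0 \sum_y1
    joint theta x y0 y1) = 1.
  under eq_bigr do rewrite joint_total.
  rewrite sumr_const card_ffun card_bool card_ord -[_ *+ _]mulr_natl mulr1.
  by rewrite natrX -exprMn mulVf ?expr1n // pnatr_eq0.
rewrite -[X in _ <= X + _]total -mulrDr ler_pM2l // -big_split /=.
apply: ler_sum => theta _.
apply: le_trans (lerD (accept_joint0 theta) (accept_joint1 theta)) _.
rewrite -!big_split; apply: ler_sum => x _ /=.
rewrite -!big_split; apply: ler_sum => y0 _ /=.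
rewrite -!big_split; apply: ler_sum => y1 _ /=.
rewrite -mulrDl -[X in _ <= X + _]mul1r -mulrDl.
apply: ler_wpM2r; first exact: joint_ge0.
by rewrite /both_close; case: close; case: close; rewrite ?(addr0, add0r).
Qed.

End Attack.

Theorem proposition5p1 (R : realType) (n : nat) (hn : (1 <= n)%N)
  (psi : bool -> bool -> 'cV[R[i]]_2)
  (hpsi : forall t : bool, orthonormal_basis2 (psi t))
  (delta : R)
  (hdelta : delta = 0 \/ 0 < delta < lambda1 psi)
  (s : strategy R n) :
  accept_prob psi delta s false + accept_prob psi delta s true
    <= (1 + epsilon n psi delta)%:C.
Proof.
have l01 : lambda0 psi + lambda1 psi = 1 by rewrite /lambda0 /lambda1; field.
have l0_ge0 : 0 <= lambda0 psi.
  by rewrite divr_ge0 // addr_ge0 // overlap_ge0.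
have [t [a [t01 a_ge0 at_ge1 le_eps]]] :=
  chernoff_parameters n l01 l0_ge0 hdelta.
(* The parameters t and a do not depend on [Y], so a single bound serves all announced strings. *)
have := accept_prob_le s hpsi (fun Y => psd_both_close hpsi Y t01 a_ge0 at_ge1).
move/le_trans; apply.
by rewrite rmorphD rmorph1 lerD2l lecR.
Qed.
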